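(* Let $m,n\geq 2$ be integers, let $k=\min\{m,n\}$, and let $A\in\mathbb{R}^{m\times n}$ be a real matrix with $A<0$ (all entries negative). For every $r\in[2,k]$ and every $r\times r$ contiguous submatrix $A_r$ of $A$, fix an arbitrary choice of a nonzero vector $\alpha=(\alpha_1,-\alpha_2,\ldots,(-1)^{r-1}\alpha_r)^T\in\mathbb{R}^r$ with either all $\alpha_i\geq 0$ or all $\alpha_i\leq 0$ ($\alpha$ may depend on $A_r$), and define $$x^{A_r}:=\operatorname{adj}(A_r)\,\alpha .$$ The following statements are equivalent: (1) $A$ is totally negative. (2) For all $x\in\mathbb{R}^n_{+,-}$, $S^+(Ax)\leq S^-(x)$. Moreover, if equality holds and $Ax\neq 0$, then the first (last) component of $Ax$ (if zero, the unique sign given to it in determining $S^+(Ax)$) has the same sign as the first (last) nonzero component of $x$. (3) For every $r\in[2,k]$ and every $r\times r$ contiguous submatrix $A_r$ of $A$, $S^+(A_rx^{A_r})\leq S^-(x^{A_r})$. If equality occurs here, then the first (last) component of $A_rx^{A_r}$ (if zero, the unique sign given to it in determining $S^+(A_rx^{A_r})$) has the same sign as the first (last) nonzero component of $x^{A_r}$.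
   Context: A real $m\times n$ matrix is totally negative if all its minors of every order at most $\min\{m,n\}$ are negative. A contiguous submatrix is a submatrix whose rows and columns are indexed by sets of consecutive integers. $\operatorname{adj}(A_r)$ is the adjugate matrix of $A_r$. $[a,b]$ denotes the set of integers from $a$ to $b$. $\mathbb{R}^n_{+,-}$ is the set of vectors in $\mathbb{R}^n$ with at least one positive and at least one negative coordinate. For $x\in\mathbb{R}^n$, $S^-(x)$ is the number of sign changes in the sequence of coordinates of $x$ after removing all zero entries; $S^+(x)$ is the maximum possible number of sign changes obtained after assigning a value $\pm1$ to each zero entry of $x$. For $0\in\mathbb{R}^n$, $S^+(0):=n$ and $S^-(0):=0$. ''First (last)'' means the assertion holds for the first components and also for the last components. *)

(* Defs.v *)
From mathcomp Require Import all_boot all_order all_algebra.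
From mathcomp Require Import reals.
From mathcomp Require Import qe_rcf_th.

Set Implicit Arguments.
Unset Strict Implicit.
Unset Printing Implicit Defensive.

Import Order.TTheory GRing.Theory Num.Theory.
Local Open Scope ring_scope.

Definition increasing (r n : nat) (f : 'I_r -> 'I_n) : Prop :=
  forall s t : 'I_r, (s < t)%N -> (f s < f t)%N.

Definition totally_negative (R : realType) (m n : nat) (A : 'M[R]_(m, n)) : Prop :=
  forall (r : nat) (f : 'I_r -> 'I_m) (g : 'I_r -> 'I_n),
    (1 <= r <= minn m n)%N -> increasing f -> increasing g ->
    \det (mxsub f g A) < 0.

(* Rows i, ..., i + r - 1 and columns j, ..., j + r - 1 of A, counted from 0. *)
Definition contiguous_submx (R : realType) (m n r i j : nat)
    (hi : (i + r <= m)%N) (hj : (j + r <= n)%N) (A : 'M[R]_(m, n)) : 'M[R]_r :=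
  mxsub (fun s : 'I_r => widen_ord hi (rshift i s))
        (fun t : 'I_r => widen_ord hj (rshift j t)) A.

Definition mixed_sign (R : realType) (n : nat) (x : 'cV[R]_n) : Prop :=
  (exists i, 0 < x i 0) /\ (exists j, x j 0 < 0).

Definition coords (R : realType) (n : nat) (x : 'cV[R]_n) : seq R :=
  [seq x i 0 | i <- enum 'I_n].

Definition nonzero_coords (R : realType) (n : nat) (x : 'cV[R]_n) : seq R :=
  [seq a <- coords x | a != 0].

(* [changes] counts the consecutive pairs with negative product, so zeros have
   to be removed beforehand. *)
Definition Sminus (R : realType) (n : nat) (x : 'cV[R]_n) : nat :=
  changes (nonzero_coords x).

(* Each zero entry of x is replaced by 1 or -1 as prescribed by e. *)
Definition fill (R : realType) (n : nat) (x : 'cV[R]_n) (e : {ffun 'I_n -> bool}) :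
    'cV[R]_n :=
  \col_i (if x i 0 == 0 then (-1) ^+ e i else x i 0).

Definition Splus (R : realType) (n : nat) (x : 'cV[R]_n) : nat :=
  if x == 0 then n
  else (\max_(e : {ffun 'I_n -> bool}) Sminus (fill x e))%N.

(* The first (last) component of y, with the sign given to it in determining
   S^+(y) if it is zero, has the same sign as the first (last) nonzero component
   of x.  For y != 0 some e attains S^+(y), and all such e give the same sign to
   the first (last) component of y; for y = 0 (and n > 0) none does. *)
Definition same_end_signs (R : realType) (n p : nat) (y : 'cV[R]_p) (x : 'cV[R]_n) :
    Prop :=
  forall e : {ffun 'I_p -> bool}, Sminus (fill y e) = Splus y ->
    Num.sg (head 0 (coords (fill y e))) = Num.sg (head 0 (nonzero_coords x)) /\
    Num.sg (last 0 (coords (fill y e))) = Num.sg (last 0 (nonzero_coords x)).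

(* alpha = (a_1, -a_2, ..., (-1)^(r-1) a_r)^T with all a_i >= 0 or all a_i <= 0;
   indices are counted from 0 below. *)
Definition alternating_vector (R : realType) (r : nat) (alpha : 'cV[R]_r) : Prop :=
  exists a : 'cV[R]_r,
    alpha = \col_i ((-1) ^+ i * a i 0) /\
    ((forall i, 0 <= a i 0) \/ (forall i, a i 0 <= 0)).

(* Main.v *)
Require Import Defs.
From mathcomp Require Import all_boot all_order all_algebra.
From mathcomp Require Import reals qe_rcf_th.
From mathcomp Require Import zify ring.

Set Implicit Arguments.
Unset Strict Implicit.
Unset Printing Implicit Defensive.

Import Order.TTheory GRing.Theory Num.Theory.
Local Open Scope ring_scope.

(** Signs of minors and numbers of sign changes are linked by Cramer's rule.  Let
    [N] be a square matrix of order [q.+1] with negative determinant whose minors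
    of order [q] are negative.  In [\adj N *m (N *m y) = \det N *: y] the first
    row of [\adj N] alternates in sign; so if [N *m y] weakly alternates, then its
    first sign is that of [y_0] ([cramer_sign]).

    A totally negative [A] diminishes sign changes as follows.  If [x] has [q] sign
    changes, it splits into [q.+1] blocks of constant sign.  Collapsing each block
    to one coordinate gives [A *m x = B *m y], where [y] has order [q.+1] and
    strictly alternates, and where the minors of [B] are still negative, being
    nonnegative combinations of minors of [A] ([negative_minors_blocks]).  By
    [cramer_sign], any weakly alternating choice of [q.+1] entries of [A *m x]
    starts with the first sign of [x] ([image_alternation]).  This gives the
    assertion on the end signs.  It also excludes [q.+2] weakly alternating entries:
    dropping either the last or the first of them leaves choices that start with
    opposite signs.

    Conversely, the minors are shown to be negative by induction on their order.
    Let [M] be a submatrix of order [q.+1], the minors of order [q] being negative,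
    and let [alpha] weakly alternate with first sign [d].  Then
    [x = \adj M *m alpha] strictly alternates with first sign [- d]
    ([adj_alternates]), while [M *m x = \det M *: alpha].  Were [\det M]
    nonnegative, [M *m x] would weakly alternate with first sign [d]: either it is
    zero and has too many sign changes by convention, or it has as many as [x] but
    the wrong end signs ([opposite_alternation_absurd]).  When the hypothesis
    concerns all [x], this applies to every submatrix [M].  When it concerns
    contiguous submatrices, it gives the contiguous minors, and a criterion of
    Fekete's type passes from them to all minors of the same order
    ([negative_minors_contiguous]); [cramer_sign] proves it as well. *)

(** * Sign blocks of a vector *)

Section SignChanges.
Variable R : realType.
Implicit Types (s : seq R) (a d : R).

Local Notation nonzero s := [seq a <- s | a != 0].

Lemma changes_rcons s a :
  changes (rcons s a) = (changes s + (last 0%R s * a < 0)%R)%N.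
Proof.
elim: s => [|b s IH] /=; first by rewrite mulr0 mul0r ltxx.
rewrite IH addnA; case: s {IH} => [|c s] //=.
by rewrite mulr0 mul0r ltxx !addn0.
Qed.

(** Each sign change flips the current sign, so its parity relates the first sign
    to the last one. *)
Lemma last_sign s : all (fun a => a != 0) s -> s != [::] ->
  0 < head 0 s * (-1) ^+ changes s * last 0 s.
Proof.
elim/last_ind: s => [//|s a IH]; rewrite all_rcons => /andP[a0 s0] _.
rewrite changes_rcons last_rcons.
case: s IH s0 => [|b s] IH s0.
  by rewrite /= mul0r ltxx expr0 mulr1 -expr2 exprn_even_gt0.
have {IH} := IH s0 isT.
have : last b s != 0 by have /allP := s0; apply; exact: mem_last.
rewrite [head _ _]/= [head _ (rcons _ _)]/= [last 0 _]/=.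
set l := last b s; set h := b * _ => l0 hl.
have l2 : 0 < l * l by rewrite -expr2 exprn_even_gt0.
have [la|la] := ltP (l * a) 0.
  have : (h * l) * (l * a) < 0 by rewrite pmulr_rlt0.
  rewrite mulrACA [l * a]mulrC mulrACA pmulr_llt0 // addn1 exprSr mulrN1 mulrN mulNr.
  by rewrite oppr_gt0.
have {}la : 0 < l * a by rewrite lt_neqAle la eq_sym mulf_neq0.
have := mulr_gt0 hl la; rewrite [l * a]mulrC mulrACA pmulr_lgt0 // addn0; apply.
Qed.

(** For a nonzero entry at position [i], [prefix_changes s i.+1] is the rank of the
    block of constant sign containing it. *)
Definition prefix_changes s i := changes (nonzero (take i s)).

Lemma prefix_changesS s i : (i < size s)%N ->
  prefix_changes s i.+1 =
    (prefix_changes s i + (last 0%R (nonzero (take i s)) * nth 0%R s i < 0)%R)%N.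
Proof.
move=> lt_i; rewrite /prefix_changes (take_nth 0) // filter_rcons.
by case: eqVneq => [->|_]; rewrite /= ?mulr0 ?ltxx ?addn0 // changes_rcons.
Qed.

Lemma prefix_changes_le s i j : (i <= j)%N ->
  (prefix_changes s i <= prefix_changes s j)%N.
Proof.
move/subnK <-; elim: (j - i)%N => // k; rewrite addSn => /leq_trans; apply.
have [lt_ki|le_ki] := ltnP (k + i) (size s).
  by rewrite prefix_changesS // leq_addr.
by rewrite /prefix_changes !take_oversize // ltnW.
Qed.

Lemma prefix_changes_sign s i : (i < size s)%N -> nth 0 s i != 0 ->
  0 < head 0 (nonzero s) * (-1) ^+ prefix_changes s i.+1 * nth 0 s i.
Proof.
move=> lt_i si0; set t := nonzero (take i.+1 s).
have defl : t = rcons (nonzero (take i s)) (nth 0 s i).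
  by rewrite /t (take_nth 0) // filter_rcons si0.
have t0 : t != [::] by rewrite defl -size_eq0 size_rcons.
have := last_sign (filter_all _ _) t0; rewrite -/t.
rewrite {3}defl last_rcons /prefix_changes -/t.
suff -> : head 0 t = head 0 (nonzero s) by [].
rewrite -[in RHS](cat_take_drop i.+1 s) filter_cat -/t.
by case: (t) t0.
Qed.

(** The count grows by at most one per entry, and only at nonzero entries, so no
    rank is skipped. *)
Lemma prefix_changes_onto s k : nonzero s != [::] ->
  (k <= changes (nonzero s))%N ->
  exists i, [/\ (i < size s)%N, nth 0 s i != 0 & prefix_changes s i.+1 = k].
Proof.
elim/last_ind: s => [//|s a IH].
have old : (exists i, [/\ (i < size s)%N, nth 0 s i != 0 & prefix_changes s i.+1 = k])
  -> exists i, [/\ (i < size (rcons s a))%N, nth 0 (rcons s a) i != 0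
                 & prefix_changes (rcons s a) i.+1 = k].
  case=> i [lt_i si0 ik]; exists i; rewrite size_rcons ltnS ltnW // nth_rcons lt_i.
  by split=> //; rewrite -ik /prefix_changes -cats1 takel_cat.
rewrite filter_rcons; have [a0|a0 _] := eqVneq a 0; first by move=> h1 h2; exact/old/IH.
rewrite changes_rcons leq_eqVlt => /predU1P[->|].
  exists (size s); rewrite size_rcons leqnn nth_rcons ltnn eqxx; split=> //.
  rewrite /prefix_changes -(size_rcons s a) take_size filter_rcons a0.
  by rewrite changes_rcons.
have [->|s0] := eqVneq (nonzero s) [::]; first by rewrite /= mul0r ltxx.
move=> lt_k; apply/old/IH => //.
by move: lt_k; case: (_ < 0)%R; rewrite ?addn1 ?addn0 // => /ltnW.
Qed.

Lemma size_coords n (x : 'cV[R]_n) : size (coords x) = n.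
Proof. by rewrite size_map size_enum_ord. Qed.

Lemma nth_coords n (x : 'cV[R]_n) (i : 'I_n) : nth 0 (coords x) i = x i 0.
Proof. by rewrite (nth_map i) ?size_enum_ord // nth_ord_enum. Qed.

Lemma nonzero_coords_eq0 n (x : 'cV[R]_n) : x != 0 -> nonzero_coords x != [::].
Proof.
apply: contraNneq => x0; apply/eqP/matrixP => i j; rewrite ord1 mxE.
apply/eqP; apply: contraT => xi0.
suff : x i 0 \in nonzero_coords x by rewrite x0.
by rewrite mem_filter xi0 (map_f (fun k => x k 0)) ?mem_enum.
Qed.

(** [b] numbers the blocks of constant sign from left to right, so that
    sign changes are counted by comparing block numbers. *)
Lemma sign_blocks n (x : 'cV[R]_n) : x != 0 ->
  exists b : 'I_n -> nat,
  [/\ forall i j : 'I_n, (i <= j)%N -> (b i <= b j)%N,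
      forall i, (b i <= Sminus x)%N,
      forall i, x i 0 != 0 -> 0 < head 0 (nonzero_coords x) * (-1) ^+ b i * x i 0
    & forall k, (k <= Sminus x)%N -> exists2 i, x i 0 != 0 & b i = k].
Proof.
move=> x0; exists (fun i => prefix_changes (coords x) i.+1); split.
- by move=> i j le_ij; apply: prefix_changes_le.
- move=> i; have := @prefix_changes_le (coords x) i.+1 n (ltn_ord i).
  by rewrite {2}/prefix_changes -{3}(size_coords x) take_size.
- move=> i xi0; rewrite -[in X in _ * X]nth_coords.
  by apply: prefix_changes_sign; rewrite ?size_coords // nth_coords.
- move=> k /(prefix_changes_onto (nonzero_coords_eq0 x0))[i []].
  rewrite size_coords => lt_i; rewrite -[i]/(val (Ordinal lt_i)) nth_coords => xi0 bi.
  by exists (Ordinal lt_i).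
Qed.

Lemma last_nonzero_sign n (x : 'cV[R]_n) : x != 0 ->
  0 < head 0 (nonzero_coords x) * (-1) ^+ Sminus x * last 0 (nonzero_coords x).
Proof. by move=> x0; apply: last_sign (filter_all _ _) (nonzero_coords_eq0 x0). Qed.

End SignChanges.

(** * Sign changes as alternating subvectors *)

Lemma increasing_inj r n (f : 'I_r -> 'I_n) : increasing f -> injective f.
Proof.
move=> fi s t fst; apply/val_inj.
by case: (ltngtP s t) => // /fi; rewrite fst ltnn.
Qed.

Lemma increasing_comp p r n (g : 'I_r -> 'I_n) (f : 'I_p -> 'I_r) :
  increasing g -> increasing f -> increasing (g \o f).
Proof. by move=> gi fi s t /fi/gi. Qed.

Lemma increasing_leq r n (f : 'I_r -> 'I_n) : increasing f -> (r <= n)%N.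
Proof. by move=> /increasing_inj/leq_card; rewrite !card_ord. Qed.

Lemma increasing_lift n (i : 'I_n.+1) : increasing (lift i).
Proof. by move=> s t; rewrite !ltnNge /= leq_bump2. Qed.

Section Alternation.
Variable R : realType.
Implicit Types d : R.

(** Only the sign of [d] matters: it is the one prescribed at index 0. *)
Definition strictly_alternates d p (v : 'I_p -> R) :=
  forall k : 'I_p, 0 < d * (-1) ^+ k * v k.

Definition weakly_alternates d p (v : 'I_p -> R) :=
  forall k : 'I_p, 0 <= d * (-1) ^+ k * v k.

Lemma sgr_eq (a b : R) : 0 < a * b -> Num.sg a = Num.sg b.
Proof.
move=> ab; have [a0|a0|a0] := ltrgt0P a; last by rewrite a0 mul0r ltxx in ab.
  by move: ab; rewrite pmulr_rgt0 // => b0; rewrite !gtr0_sg.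
by move: ab; rewrite nmulr_rgt0 // => b0; rewrite !ltr0_sg.
Qed.

Lemma mulr_gt0_trans (b a c : R) : 0 < a * b -> 0 < b * c -> 0 < a * c.
Proof.
move=> ab bc; have := mulr_gt0 ab bc; rewrite mulrA -[a * b * b]mulrA mulrAC.
by rewrite pmulr_lgt0 // -expr2 exprn_even_gt0 //; apply: contraTneq ab => ->; rewrite mulr0 ltxx.
Qed.

(** A strictly alternating subvector visits a new sign block at each step; when
    it has as many entries as there are blocks, it starts in the first one and
    ends in the last one. *)
Lemma Sminus_ge n (x : 'cV[R]_n) p (f : 'I_p.+1 -> 'I_n) d : increasing f ->
  strictly_alternates d (fun k => x (f k) 0) ->
  (p <= Sminus x)%N /\
  (Sminus x = p -> 0 < d * head 0 (nonzero_coords x) /\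
                   0 < d * (-1) ^+ p * last 0 (nonzero_coords x)).
Proof.
move=> fi alt; have xf k : x (f k) 0 != 0.
  by apply: contraTneq (alt k) => ->; rewrite mulr0 ltxx.
have x0 : x != 0 by apply: contraNneq (xf ord0) => ->; rewrite mxE.
have [b [bmono bS bsg _]] := sign_blocks x0.
set h := head 0 _ in bsg *.
have par (k : 'I_p.+1) : 0 < d * (-1) ^+ k * (h * (-1) ^+ b (f k)).
  by apply: mulr_gt0_trans (alt k) _; rewrite mulrC bsg.
have step k : (k <= p)%N -> (k + b (f ord0) <= b (f (inord k)))%N.
  elim: k => [|k IH] le_kp.
    by rewrite add0n (_ : inord 0 = ord0) //; apply/val_inj; rewrite /= inordK.
  have ik : @inord p k = k :> nat by rewrite inordK // ltnW.
  have ik1 : @inord p k.+1 = k.+1 :> nat by rewrite inordK.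
  apply: leq_ltn_trans (IH (ltnW le_kp)) _; rewrite ltn_neqAle bmono; last first.
    by apply/ltnW/fi; rewrite ik ik1.
  rewrite andbT; apply/eqP => eqb; have := par (inord k); have := par (inord k.+1).
  rewrite -eqb ik ik1 exprS mulN1r mulrN mulNr oppr_gt0.
  by move=> /lt_trans h1 /h1; rewrite ltxx.
have pS : (p + b (f ord0) <= Sminus x)%N.
  apply: leq_trans (step p (leqnn p)) (bS _).
split; first exact: leq_trans (leq_addr _ _) pS.
move=> Sp; have bf0 : b (f ord0) = 0%N by lia.
have dh : 0 < d * h by have := par ord0; rewrite bf0 !expr0 !mulr1.
split=> //; have := last_nonzero_sign x0; rewrite -/h Sp => hl.
by rewrite -mulrA; apply: mulr_gt0_trans dh _; rewrite mulrA.
Qed.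

(** One nonzero entry per sign block. *)
Lemma Sminus_pick n (x : 'cV[R]_n) : x != 0 ->
  exists f : 'I_(Sminus x).+1 -> 'I_n, increasing f /\
  strictly_alternates (head 0 (nonzero_coords x)) (fun k => x (f k) 0).
Proof.
move=> x0; have [b [bmono _ bsg bonto]] := sign_blocks x0.
have [f xf bf] := fin_all_exists2 (fun k : 'I_(Sminus x).+1 => bonto k (ltn_ord k)).
exists f; split=> [s t lt_st|k]; last by rewrite -[X in _ ^+ X](bf k) bsg.
by rewrite ltnNge; apply/negP => /bmono; rewrite !bf leqNgt lt_st.
Qed.

Lemma Sminus_lt_support n (x : 'cV[R]_n) (I : {set 'I_n}) : x != 0 ->
  (forall i, x i 0 != 0 -> i \in I) -> (Sminus x < #|I|)%N.
Proof.
move=> x0 xI; have [f [fi alt]] := Sminus_pick x0.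
rewrite -[X in (X <= _)%N]card_ord -cardsT -(card_imset _ (increasing_inj fi)).
apply/subset_leq_card/subsetP => _ /imsetP[k _ ->]; apply: xI.
by apply: contraTneq (alt k) => ->; rewrite mulr0 ltxx.
Qed.

Lemma mixed_sign_Sminus n (x : 'cV[R]_n) :
  mixed_sign x -> x != 0 /\ (0 < Sminus x)%N.
Proof.
case=> -[i xi] [j xj]; have x0 : x != 0.
  by apply: contraTneq xi => ->; rewrite mxE ltxx.
split=> //; have [b [_ bS bsg _]] := sign_blocks x0.
rewrite lt0n; apply/negP => /eqP S0.
have := bsg i; have := bsg j; rewrite lt_eqF // gt_eqF //.
have := bS i; have := bS j; rewrite S0 !leqn0 => /eqP -> /eqP ->.
move=> /(_ isT) + /(_ isT); rewrite !expr0 !mulr1 nmulr_lgt0 // pmulr_lgt0 //.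
by move=> /lt_trans h1 /h1; rewrite ltxx.
Qed.

Lemma fill_neq0 n (x : 'cV[R]_n) e i : fill x e i 0 != 0.
Proof. by rewrite mxE; case: ifP => [_|/negbT //]; rewrite signr_eq0. Qed.

Lemma coords_fill n (x : 'cV[R]_n) e :
  nonzero_coords (fill x e) = coords (fill x e).
Proof. by apply/all_filterP/allP => _ /mapP[i _ ->]; apply: fill_neq0. Qed.

Lemma weak_of_fill n (x : 'cV[R]_n) e p (f : 'I_p -> 'I_n) d :
  strictly_alternates d (fun k => fill x e (f k) 0) ->
  weakly_alternates d (fun k => x (f k) 0).
Proof.
move=> alt k; have := alt k; rewrite mxE.
by case: eqVneq => [->|_ /ltW //]; rewrite mulr0.
Qed.

Lemma fill_of_weak n (x : 'cV[R]_n) p (f : 'I_p -> 'I_n) d : d != 0 ->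
  increasing f -> weakly_alternates d (fun k => x (f k) 0) ->
  exists e, strictly_alternates d (fun k => fill x e (f k) 0).
Proof.
move=> d0 /increasing_inj fi alt.
(* A chosen position [f k] receives the sign of [d * (-1) ^+ k]; the other
   zeros get the default sign [+]. *)
exists [ffun i => if [pick k | f k == i] is Some k then odd k (+) (d < 0) else false].
move=> k; rewrite mxE ffunE; case: eqVneq => [_|xk]; last first.
  by rewrite lt_neqAle alt eq_sym !mulf_neq0 // signr_eq0.
case: pickP => [l /eqP/fi ->|/(_ k)]; last by rewrite eqxx.
rewrite signr_addb signr_odd -mulrA signrMK.
by case: (ltrgt0P d) d0 => [dp|dn|->]; rewrite ?expr0 ?expr1 ?mulr1 ?mulrN1 ?oppr_gt0 ?eqxx.
Qed.

End Alternation.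

(** * Determinants and negative minors *)

Section Minors.
Variable R : realType.

(** Total negativity one order at a time, for inductions on the order; it holds
    vacuously when [r] exceeds the dimensions. *)
Definition negative_minors m n (A : 'M[R]_(m, n)) r :=
  forall (f : 'I_r -> 'I_m) (g : 'I_r -> 'I_n),
    increasing f -> increasing g -> \det (mxsub f g A) < 0.

Lemma totally_negativeP m n (A : 'M[R]_(m, n)) :
  totally_negative A <-> forall r, (0 < r)%N -> negative_minors A r.
Proof.
split=> [TN r r0 f g fi gi|neg r f g /andP[r0 _]]; last exact: neg.
by apply: TN; rewrite // r0 leq_min (increasing_leq fi) (increasing_leq gi).
Qed.

Lemma negative_minors_mxsub m n p q (A : 'M[R]_(m, n)) (f : 'I_p -> 'I_m)
    (g : 'I_q -> 'I_n) r :
  increasing f -> increasing g -> negative_minors A r -> negative_minors (mxsub f g A) r.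
Proof.
move=> fi gi neg u v ui vi; rewrite -mxsub_comp.
by apply: neg; apply: increasing_comp.
Qed.

Lemma negative_minors_tr m n (A : 'M[R]_(m, n)) r :
  negative_minors A r -> negative_minors A^T r.
Proof. by move=> neg f g fi gi; rewrite -trmx_mxsub det_tr neg. Qed.

Lemma cofactor_sign m n (A : 'M[R]_(m, n)) q (f : 'I_q.+1 -> 'I_m)
    (g : 'I_q.+1 -> 'I_n) (i j : 'I_q.+1) :
  increasing f -> increasing g -> negative_minors A q ->
  (-1) ^+ (i + j) * cofactor (mxsub f g A) i j < 0.
Proof.
move=> fi gi neg; rewrite mulrA -expr2 sqrr_sign mul1r.
suff -> : row' i (col' j (mxsub f g A)) = mxsub (f \o lift i) (g \o lift j) A.
  by apply: neg; apply: increasing_comp => //; apply: increasing_lift.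
by apply/matrixP => s t; rewrite !mxE.
Qed.

(** Cramer's rule: expanding along the first column, all the terms of
    [\det N * y_0 = \sum_i cofactor_(i,0) * w_i] have the same sign. *)
Lemma cramer_sign m n (A : 'M[R]_(m, n)) q (f : 'I_q.+1 -> 'I_m)
    (g : 'I_q.+1 -> 'I_n) (y : 'cV[R]_q.+1) d :
  increasing f -> increasing g -> negative_minors A q -> \det (mxsub f g A) < 0 ->
  weakly_alternates d (fun k => (mxsub f g A *m y) k 0) -> 0 <= d * y ord0 0.
Proof.
move=> fi gi neg detN; set N := mxsub f g A in detN *; set w := N *m y => alt.
have : \det N * y ord0 0 = \sum_i cofactor N i ord0 * w i 0.
  have /matrixP/(_ ord0 0) : \adj N *m w = \det N *: y.
    by rewrite mulmxA mul_adj_mx mul_scalar_mx.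
  by rewrite !mxE => <-; apply: eq_bigr => i _; rewrite mxE.
move=> /(congr1 (fun z => d * z)); rewrite mulrCA mulr_sumr => cramer.
suff : \det N * (d * y ord0 0) <= 0 by rewrite nmulr_rle0.
rewrite cramer sumr_le0 // => i _.
have := cofactor_sign i ord0 fi gi neg; rewrite addn0 -/N => cof.
have -> : d * (cofactor N i ord0 * w i 0) =
  ((-1) ^+ i * cofactor N i ord0) * (d * (-1) ^+ i * w i 0).
  by rewrite -[LHS]mulr1 -[X in _ * X = _](sqrr_sign R i); set s := (-1) ^+ i; ring.
by rewrite mulr_le0_ge0 // ltW.
Qed.

Lemma mulmx_mxsubE m n p q r (A : 'M[R]_(m, n)) (f : 'I_p -> 'I_m) (g : 'I_q -> 'I_n)
    (y : 'M[R]_(q, r)) k j :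
  (mxsub f g A *m y) k j = (mxsub id g A *m y) (f k) j.
Proof. by rewrite !mxE; apply: eq_bigr => i _; rewrite !mxE. Qed.

(** Multilinearity of the determinant in the columns of a product. *)
Lemma det_mulmx_sum r n (M : 'M[R]_(r, n)) (N : 'M[R]_(n, r)) :
  \det (M *m N) =
    \sum_(h : {ffun 'I_r -> 'I_n}) (\prod_k N (h k) k) * \det (mxsub id h M).
Proof.
rewrite -[LHS]det_tr [LHS]/determinant.
under eq_bigr => s _ do
  (under eq_bigr => i _ do rewrite !mxE; rewrite bigA_distr_bigA mulr_sumr).
rewrite exchange_big; apply: eq_bigr => h _ /=.
rewrite -[\det (mxsub id h M)]det_tr /determinant mulr_sumr.
apply: eq_bigr => s _; rewrite big_split /= [RHS]mulrCA; congr (_ * _).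
by rewrite mulrC; congr (_ * _); apply: eq_bigr => i _; rewrite !mxE.
Qed.

(** Each column of [A *m D] is a nonnegative, nonzero combination of columns of
    [A], and the columns used for [k] all lie to the left of those used for
    [k.+1].  By multilinearity, a minor of [A *m D] is then a nonnegative
    combination of minors of [A]. *)
Lemma negative_minors_blocks m n p (A : 'M[R]_(m, n)) (D : 'M[R]_(n, p))
    (b : 'I_n -> nat) r :
  (forall i j : 'I_n, (i <= j)%N -> (b i <= b j)%N) ->
  (forall j k, 0 <= D j k) -> (forall j k, D j k != 0 -> b j = k) ->
  (forall k, exists j, D j k != 0) ->
  negative_minors A r -> negative_minors (A *m D) r.
Proof.
move=> bmono D0 Db Donto neg f g fi gi.
have -> : mxsub f g (A *m D) = mxsub f id A *m mxsub id g D.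
  by apply/matrixP => s t; rewrite !mxE; apply: eq_bigr => j _; rewrite !mxE.
have prodE (h : {ffun 'I_r -> 'I_n}) :
    \prod_k (mxsub id g D) (h k) k = \prod_k D (h k) (g k).
  by apply: eq_bigr => k _; rewrite mxE.
have term (h : {ffun 'I_r -> 'I_n}) : \prod_k D (h k) (g k) != 0 ->
    (\prod_k (mxsub id g D) (h k) k) * \det (mxsub id h (mxsub f id A)) < 0.
  rewrite prodE => pr0; have bh k : b (h k) = g k.
    by apply: Db; move/prodf_neq0: pr0; apply.
  have pr_gt0 : 0 < \prod_k D (h k) (g k).
    by rewrite lt_neqAle eq_sym pr0 prodr_ge0.
  rewrite -mxsub_comp pmulr_rlt0 //; apply: neg => [|s t lt_st]; first exact: fi.
  by rewrite /= ltnNge; apply/negP => /bmono; rewrite !bh leqNgt gi.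
have [h0 h0P] := fin_all_exists (fun k => Donto (g k)).
rewrite det_mulmx_sum (bigD1 (finfun h0)) //= ltr_nwDl //.
  by apply: term; apply/prodf_neq0 => k _; rewrite ffunE.
apply: sumr_le0 => h _.
have [pr0|/term/ltW //] := eqVneq (\prod_k D (h k) (g k)) 0.
by rewrite prodE pr0 mul0r.
Qed.

End Minors.

(** * Variation diminution *)

Section Variation.
Variable R : realType.

(** Collapsing each sign block of [x] to a single coordinate writes [A *m x] as
    [B *m y] with [y] strictly alternating, so that [cramer_sign] applies. *)
Lemma image_alternation m n (A : 'M[R]_(m, n)) (x : 'cV[R]_n) d
    (f : 'I_(Sminus x).+1 -> 'I_m) :
  x != 0 -> negative_minors A (Sminus x) -> negative_minors A (Sminus x).+1 ->
  increasing f -> weakly_alternates d (fun k => (A *m x) (f k) 0) ->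
  0 <= d * head 0 (nonzero_coords x).
Proof.
move=> x0 negq negq1 fi; have [b [bmono bS bsg bonto]] := sign_blocks x0.
set h := head 0 _ in bsg *.
pose D : 'M[R]_(n, (Sminus x).+1) := \matrix_(j, k) (`|x j 0| *+ (b j == k)).
pose y : 'cV[R]_(Sminus x).+1 := \col_k Num.sg (h * (-1) ^+ k).
have Dneq j k : D j k != 0 -> b j = k.
  by rewrite mxE; case: (b j =P k) => // _; rewrite mulr0n eqxx.
have Donto k : exists j, D j k != 0.
  have [j xj bj] := bonto k (ltn_ord k); exists j.
  by rewrite mxE bj eqxx normr_eq0.
have D0 j k : 0 <= D j k by rewrite mxE mulrn_wge0.
have xD : x = D *m y.
  apply/matrixP => j z; rewrite ord1 mxE.
  have lt_b : (b j < (Sminus x).+1)%N by rewrite ltnS.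
  rewrite (bigD1 (Ordinal lt_b)) //= big1 ?addr0 => [|k neq_k]; last first.
    have [->|/Dneq bj] := eqVneq (D j k) 0; first by rewrite mul0r.
    by case/eqP: neq_k; apply/val_inj.
  rewrite !mxE eqxx /=.
  have [->|xj] := eqVneq (x j 0) 0; first by rewrite normr0 mul0r.
  by rewrite (sgr_eq (bsg j xj)) mulrC -numEsg.
have detB r : negative_minors A r -> negative_minors (A *m D) r.
  exact: (negative_minors_blocks bmono).
have -> : A *m x = A *m D *m y by rewrite -mulmxA -xD.
move=> alt.
have dy : 0 <= d * y ord0 0.
  apply: (@cramer_sign _ _ _ (A *m D) _ f id y d) => //; first exact: detB.
    exact: detB.
  by move=> k; rewrite mulmx_mxsubE mxsub_id; apply: alt.
move: dy; rewrite mxE expr0 mulr1.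
by move=> dy; rewrite [h]numEsg mulrA mulr_ge0.
Qed.

Lemma Splus_le m (w : 'cV[R]_m) q : (w = 0 -> (m <= q)%N) ->
  (forall e, w != 0 -> (Sminus (fill w e) <= q)%N) -> (Splus w <= q)%N.
Proof.
rewrite /Splus; have [-> /(_ erefl) //|w0 _ fillq] := eqVneq w 0.
by apply/bigmax_leqP => e _; apply: fillq.
Qed.

Lemma Sminus_fill_le m (w : 'cV[R]_m) e : w != 0 -> (Sminus (fill w e) <= Splus w)%N.
Proof. by move=> /negPf w0; rewrite /Splus w0 leq_bigmax. Qed.

Lemma fill_vec_neq0 m (w : 'cV[R]_m) e : w != 0 -> fill w e != 0.
Proof.
case: m w e => [|m] w e; first by rewrite (flatmx0 w) eqxx.
by move=> _; apply: contraNneq (fill_neq0 w e ord0) => ->; rewrite mxE.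
Qed.

Lemma head_nonzero m (w : 'cV[R]_m) : w != 0 -> head 0 (nonzero_coords w) != 0.
Proof.
move=> /last_nonzero_sign; apply: contraTneq => ->.
by rewrite !mul0r ltxx.
Qed.

(** When [A *m x = 0], the bound [m <= Sminus x] holds because a zero vector weakly
    alternates with both first signs, while [image_alternation] allows only one. *)
Theorem variation_diminishing m n (A : 'M[R]_(m, n)) (x : 'cV[R]_n) :
  (forall r, (0 < r)%N -> negative_minors A r) -> mixed_sign x ->
  (Splus (A *m x) <= Sminus x)%N /\
  (Splus (A *m x) = Sminus x -> A *m x != 0 -> same_end_signs (A *m x) x).
Proof.
move=> neg /mixed_sign_Sminus[x0 q0]; set w := A *m x; set q := Sminus x in q0 *.
set h := head 0 (nonzero_coords x); have h0 : h != 0 by exact: head_nonzero.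
have sameh d (f : 'I_q.+1 -> 'I_m) : increasing f ->
    weakly_alternates d (fun k => w (f k) 0) -> 0 <= d * h.
  by apply: image_alternation => //; apply: neg.
(* One sign change too many would make both the first and the second entry of
   an alternating subvector start a full alternation, with opposite signs. *)
have short d (f : 'I_q.+2 -> 'I_m) : d != 0 -> increasing f ->
    ~ weakly_alternates d (fun k => w (f k) 0).
  move=> d0 fi alt.
  have h1 : 0 <= d * h.
    apply: (sameh d (f \o lift ord_max)); first exact: increasing_comp (increasing_lift _).
    by move=> k; have := alt (lift ord_max k); rewrite lift_max.
  have h2 : 0 <= - d * h.
    apply: (sameh (- d) (f \o lift ord0)); first exact: increasing_comp (increasing_lift _).
    by move=> k; have := alt (lift ord0 k); rewrite lift0 exprS mulN1r mulrN !mulNr.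
  have : d * h == 0 by rewrite eq_le h1 -oppr_ge0 -mulNr h2.
  by rewrite mulf_eq0 (negPf d0) (negPf h0).
have widen p (le_p : (p <= m)%N) : increasing (widen_ord le_p) by [].
split.
  apply: Splus_le => [w0|e w0].
    rewrite leqNgt; apply/negP => lt_qm.
    have alt d : weakly_alternates d (fun k => w (widen_ord lt_qm k) 0).
      by move=> k; rewrite w0 mxE mulr0.
    have := sameh h _ (widen _ lt_qm) (alt h); have := sameh (- h) _ (widen _ lt_qm) (alt _).
    rewrite mulNr oppr_ge0 -expr2 real_exprn_even_le0 // ?num_real //.
    by rewrite (negPf h0).
  rewrite leqNgt -ltnS; apply/negP => lt_q.
  have [f [fi alt]] := Sminus_pick (fill_vec_neq0 e w0).
  apply: (short (head 0 (nonzero_coords (fill w e))) (f \o widen_ord lt_q)).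
  - exact/head_nonzero/fill_vec_neq0.
  - exact: increasing_comp.
  - by move=> k; apply: (weak_of_fill alt (widen_ord lt_q k)).
move=> eqS w0 e; rewrite eqS -coords_fill => Se.
have v0 := fill_vec_neq0 e w0; set v := fill w e in Se v0 *.
have [f [fi alt]] := Sminus_pick v0.
have lt_q : (q < (Sminus v).+1)%N by rewrite Se.
have dh : 0 < head 0 (nonzero_coords v) * h.
  rewrite lt_neqAle eq_sym mulf_neq0 ?head_nonzero //=.
  apply: (sameh _ (f \o widen_ord lt_q)); first exact: increasing_comp.
  by move=> k; apply: (weak_of_fill alt (widen_ord lt_q k)).
split; first exact: sgr_eq.
apply: sgr_eq; have lx := last_nonzero_sign x0.
have := last_nonzero_sign v0; rewrite Se mulrC => lv.
apply: mulr_gt0_trans lv _; rewrite -mulrA; apply: mulr_gt0_trans dh _.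
by rewrite mulrA.
Qed.

End Variation.

(** * From contiguous minors to all minors *)

Section Contiguous.
Variable R : realType.

(** If the minor without row [j] were nonnegative, the vector [y] spanned by the
    last column of its adjugate would be mapped to a vector vanishing at all rows
    but [j] and the last one.  According to the sign at [j], this vector weakly
    alternates, starting with [+], along the rows without the first or along the
    rows without the last, which [cramer_sign] excludes since [y_0 < 0]. *)
Lemma minor_between m n (A : 'M[R]_(m, n)) q (F : 'I_q.+2 -> 'I_m)
    (g : 'I_q.+1 -> 'I_n) (j : 'I_q.+2) :
  increasing F -> increasing g -> negative_minors A q -> (0 < j < q.+1)%N ->
  \det (mxsub (F \o lift ord0) g A) < 0 -> \det (mxsub (F \o lift ord_max) g A) < 0 ->
  \det (mxsub (F \o lift j) g A) < 0.
Proof.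
move=> Fi gi neg /andP[j0 jq] det0 detmax.
have liftF i : increasing (F \o lift i) by exact: increasing_comp (increasing_lift _).
set M := mxsub (F \o lift j) g A; rewrite ltNge; apply/negP => detM.
pose y : 'cV[R]_q.+1 := \adj M *m ((-1) ^+ q *: delta_mx ord_max 0).
have y0 : y ord0 0 < 0.
  rewrite /y -scalemxAr -colE !mxE -[q in _ ^+ q]addn0.
  exact: (cofactor_sign ord_max ord0 (liftF j) gi neg).
pose v i := (mxsub id g A *m y) i 0.
have vF s : s != j -> v (F s) = (-1) ^+ q * \det M * (s == ord_max)%:R.
  case: (unliftP j s) => [k -> _|->]; last by rewrite eqxx.
  rewrite /v -[F _]/((F \o lift j) k) -mulmx_mxsubE -/M /y mulmxA mul_mx_adj.
  rewrite mul_scalar_mx scalerA [_ * (-1) ^+ q]mulrC !mxE eqxx andbT.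
  have -> : ord_max = lift j ord_max.
    by apply/val_inj; rewrite /= /bump -ltnS jq.
  by rewrite (inj_eq lift_inj).
have no_alt i : \det (mxsub (F \o lift i) g A) < 0 ->
    ~ weakly_alternates 1 (fun k => v (F (lift i k))).
  move=> deti alt; have : 0 <= 1 * y ord0 0.
    apply: (cramer_sign (liftF i) gi neg deti).
    by move=> k; rewrite mulmx_mxsubE; apply: alt.
  by rewrite mul1r leNgt y0.
have [uj|uj] := leP 0 ((-1) ^+ j.-1 * v (F j)).
  apply: (no_alt _ det0) => k; rewrite mul1r.
  have [lk|/vF ->] := eqVneq (lift ord0 k) j; first by move: uj; rewrite -lk lift0.
  have [lk|_] := eqVneq (lift ord0 k) ord_max; last by rewrite !mulr0.
  have -> : k = q :> nat by have /(congr1 (@nat_of_ord _)) := lk; rewrite lift0 => -[].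
  by rewrite mulr1 mulrA -expr2 sqrr_sign mul1r.
apply: (no_alt _ detmax) => k; rewrite mul1r.
have [lk|/vF ->] := eqVneq (lift ord_max k) j.
  rewrite -(lift_max k) lk -(prednK j0) exprS mulN1r mulNr oppr_ge0; exact: ltW.
by rewrite eq_sym (negPf (neq_lift _ _)) !mulr0.
Qed.

Lemma increasing_homo r n (f : 'I_r -> 'I_n) (s t : 'I_r) :
  increasing f -> (s <= t)%N -> (f s <= f t)%N.
Proof.
by move=> fi; rewrite leq_eqVlt => /predU1P[/val_inj -> //|/fi/ltnW].
Qed.

(** A set of rows that are not consecutive misses a row [j] strictly between its
    first and its last one; adding [j] and dropping the first or the last row
    gives two sets with smaller spread, to which [minor_between] reduces it. *)
Lemma negative_minors_consecutive_rows m n (A : 'M[R]_(m, n)) q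
    (g : 'I_q.+1 -> 'I_n) :
  (0 < q)%N -> increasing g -> negative_minors A q ->
  (forall i (hi : (i + q.+1 <= m)%N),
     \det (mxsub (fun s => widen_ord hi (rshift i s)) g A) < 0) ->
  forall f : 'I_q.+1 -> 'I_m, increasing f -> \det (mxsub f g A) < 0.
Proof.
move=> q0 gi neg contig f; have [N] := ubnP (f ord_max - f ord0)%N.
elim: N => // N IH in f *; rewrite ltnS => spread fi.
(* A gap is an index [k] with a free row between [f k] and [f k.+1]. *)
pose lo (k : 'I_q) := widen_ord (leqnSn q) k.
have [/existsP[k gap]|/existsPn nogap] :=
    boolP [exists k : 'I_q, ((f (lo k)).+1 < f (lift ord0 k))%N]; last first.
  have fE k (lt_k : (k < q.+1)%N) : f (Ordinal lt_k) = (f ord0 + k)%N :> nat.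
    elim: k lt_k => [|k IHk] lt_k; first by rewrite addn0; congr (val (f _)); apply/val_inj.
    have lt_kq : (k < q)%N by [].
    have := nogap (Ordinal lt_kq); rewrite -leqNgt.
    rewrite (_ : lift _ _ = Ordinal lt_k); last exact/val_inj.
    rewrite (_ : lo _ = Ordinal (ltnW lt_k)); last exact/val_inj.
    have : (f (Ordinal (ltnW lt_k)) < f (Ordinal lt_k))%N by apply: fi.
    by rewrite IHk addnS => h1 h2; apply/eqP; rewrite eqn_leq h1 h2.
  have hi : (f ord0 + q.+1 <= m)%N.
    by rewrite addnS -(fE q (ltnSn q)) ltn_ord.
  rewrite (_ : mxsub f g A = mxsub (fun s => widen_ord hi (rshift (f ord0) s)) g A) //.
  apply/matrixP => s t; rewrite !mxE; congr (A _ _); apply/val_inj => /=.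
  by case: s => s lt_s; rewrite fE.
have ltm : ((f (lo k)).+1 < m)%N by apply: leq_trans gap (ltnW (ltn_ord _)).
have lt_j : (k.+1 < q.+2)%N by rewrite !ltnS ltnW.
pose j : 'I_q.+2 := Ordinal lt_j.
pose F s := if unlift j s is Some l then f l else Ordinal ltm.
have Flift l : F (lift j l) = f l by rewrite /F liftK.
have Fj : F j = Ordinal ltm by rewrite /F unlift_none.
have Fi : increasing F.
  move=> s t; case: (unliftP j s) => [a ->|->]; case: (unliftP j t) => [b ->|->].
  - by rewrite !Flift => lt_ab; apply: fi; move: lt_ab; rewrite !ltnNge leq_bump2.
  - rewrite Flift Fj /= /bump => lt_a; rewrite ltnS increasing_homo //=.
    by move: lt_a; case: leqP; lia.
  - rewrite Flift Fj /= /bump => lt_b; apply: leq_trans gap _.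
    apply: increasing_homo => //; rewrite lift0.
    by move: lt_b; case: leqP; lia.
  - by rewrite ltnn.
have F0 : F ord0 = f ord0 by rewrite -(Flift ord0); congr F; apply/val_inj.
have Fmax : F ord_max = f ord_max.
  rewrite -(Flift ord_max); congr F; apply/val_inj.
  by rewrite /= /bump; have := ltn_ord k; case: leqP; lia.
have liftF i : increasing (F \o lift i) by exact: increasing_comp (increasing_lift _).
have -> : mxsub f g A = mxsub (F \o lift j) g A.
  by apply/matrixP => s t; rewrite !mxE /= Flift.
apply: minor_between => //; first by rewrite /= ltnS ltn_ord.
- apply: IH; last exact: liftF.
  have -> : (F \o lift ord0) ord_max = f ord_max.
    by rewrite /= -Fmax; congr F; apply/val_inj.
  have F01 : (F ord0 < (F \o lift ord0) ord0)%N by apply: Fi.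
  have F1m : ((F \o lift ord0) ord0 <= F ord_max)%N.
    by apply: increasing_homo => //; apply: leq_ord.
  by move: F01 F1m; rewrite F0 Fmax; lia.
- apply: IH; last exact: liftF.
  have -> : (F \o lift ord_max) ord0 = f ord0.
    by rewrite /= -F0; congr F; apply/val_inj; rewrite /= /bump; case: leqP.
  have F01 : ((F \o lift ord_max) ord_max < F ord_max)%N.
    by apply: Fi; rewrite lift_max.
  have F1m : (F ord0 <= (F \o lift ord_max) ord_max)%N by apply: increasing_homo.
  by move: F01 F1m; rewrite F0 Fmax; lia.
Qed.

Lemma increasing_shift r m i (hi : (i + r <= m)%N) :
  increasing (fun s : 'I_r => widen_ord hi (rshift i s)).
Proof. by move=> s t; rewrite /= ltn_add2l. Qed.

(** The criterion for rows is applied first to contiguous columns, then to the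
    columns of an arbitrary choice of rows. *)
Lemma negative_minors_contiguous m n (A : 'M[R]_(m, n)) q :
  (0 < q)%N -> negative_minors A q ->
  (forall i j (hi : (i + q.+1 <= m)%N) (hj : (j + q.+1 <= n)%N),
     \det (contiguous_submx hi hj A) < 0) ->
  negative_minors A q.+1.
Proof.
move=> q0 neg contig f g fi gi.
(* Transposed, the free columns [g] become the free rows. *)
rewrite -det_tr trmx_mxsub.
apply: negative_minors_consecutive_rows => //; first exact: negative_minors_tr.
move=> j hj; rewrite -trmx_mxsub det_tr.
apply: negative_minors_consecutive_rows => //; first exact: increasing_shift.
by move=> i hi; apply: contig.
Qed.

End Contiguous.

(** * Determining the sign of a minor from variation diminution *)

Section Converse.
Variable R : realType.

Lemma alternating_weak r (alpha : 'cV[R]_r) : alternating_vector alpha ->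
  exists2 d : R, d != 0 & weakly_alternates d (fun k => alpha k 0).
Proof.
case=> a [-> signa].
have [d d0 da] : exists2 d : R, d != 0 & forall i, 0 <= d * a i 0.
  case: signa => sa; [exists 1 | exists (-1)]; rewrite ?oppr_eq0 ?oner_eq0 // => i.
    by rewrite mul1r.
  by rewrite mulN1r oppr_ge0.
by exists d => // k; rewrite mxE -mulrA signrMK.
Qed.

(** The cofactors of order [q] carry a checkerboard of signs, against which the
    alternation of [alpha] leaves no cancellation. *)
Lemma adj_alternates m n (A : 'M[R]_(m, n)) q (f : 'I_q.+1 -> 'I_m)
    (g : 'I_q.+1 -> 'I_n) (alpha : 'cV[R]_q.+1) (d : R) :
  increasing f -> increasing g -> negative_minors A q ->
  d != 0 -> alpha != 0 -> weakly_alternates d (fun k => alpha k 0) ->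
  strictly_alternates (- d) (fun k => (\adj (mxsub f g A) *m alpha) k 0).
Proof.
move=> fi gi neg d0 alpha0 alt i; set M := mxsub f g A.
have [j aj] : exists j, alpha j 0 != 0.
  apply/existsP; apply: contraNT alpha0 => /existsPn a0.
  by apply/eqP/matrixP => s t; rewrite ord1 mxE; apply/eqP/negPn/a0.
have -> : - d * (-1) ^+ i * (\adj M *m alpha) i 0 =
    \sum_(k < q.+1) - ((-1) ^+ (k + i) * cofactor M k i) * (d * (-1) ^+ k * alpha k 0).
  rewrite mxE mulr_sumr; apply: eq_bigr => k _; rewrite mxE exprD.
  rewrite -[LHS]mulr1 -[X in _ * X = _](sqrr_sign R k).
  by set s := (-1) ^+ k; set t := (-1) ^+ i; ring.
have term (k : 'I_q.+1) : 0 <= - ((-1) ^+ (k + i) * cofactor M k i) * (d * (-1) ^+ k * alpha k 0).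
  by rewrite mulr_ge0 // oppr_ge0 ltW // cofactor_sign.
rewrite (bigD1 j) //= ltr_pwDl ?sumr_ge0 // mulr_gt0 ?oppr_gt0 ?cofactor_sign //.
by rewrite lt_neqAle eq_sym alt !mulf_neq0 // signr_eq0.
Qed.

Lemma alternates_mixed n (x : 'cV[R]_n) q (f : 'I_q.+1 -> 'I_n) d : (0 < q)%N ->
  strictly_alternates d (fun k => x (f k) 0) -> mixed_sign x.
Proof.
case: q f => // q f _ alt.
have := alt ord0; rewrite expr0 mulr1 => h0.
have := alt (lift ord0 ord0); rewrite lift0 expr1 mulrN1 mulNr oppr_gt0 => h1.
have [dp|dn|d0] := ltrgt0P d; last by rewrite d0 mul0r ltxx in h0.
  rewrite pmulr_rgt0 // in h0; rewrite pmulr_rlt0 // in h1.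
  by split; [exists (f ord0)|exists (f (lift ord0 ord0))].
rewrite nmulr_rgt0 // in h0; rewrite nmulr_rlt0 // in h1.
by split; [exists (f (lift ord0 ord0))|exists (f ord0)].
Qed.

(** The weak alternation of [w] forces equality of the numbers of sign changes,
    hence the end signs agree; but they were assumed to be opposite. *)
Lemma opposite_alternation_absurd m n (w : 'cV[R]_m) (x : 'cV[R]_n) q
    (F : 'I_q.+1 -> 'I_m) d :
  increasing F -> d != 0 -> Sminus x = q -> 0 < - d * head 0 (nonzero_coords x) ->
  (Splus w <= Sminus x)%N ->
  (w != 0 -> Splus w = Sminus x -> same_end_signs w x) ->
  ~ weakly_alternates d (fun k => w (F k) 0).
Proof.
move=> Fi d0 Sx hx; rewrite Sx => Sw same alt.
have w0 : w != 0.
  apply: contraTneq Sw => ->; rewrite /Splus eqxx -ltnNge.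
  exact: increasing_leq Fi.
have [e alte] := fill_of_weak d0 Fi alt.
have [qS ends] := Sminus_ge Fi alte.
have Se := Sminus_fill_le e w0.
have eqS : Splus w = q by apply/eqP; rewrite eqn_leq Sw (leq_trans qS Se).
have eqe : Sminus (fill w e) = q by apply/eqP; rewrite eqn_leq qS -eqS Se.
have [] := same w0 eqS e _; first by rewrite eqe eqS.
have [/sgr_eq hd _] := ends eqe; rewrite -coords_fill -hd -(sgr_eq hx) sgrN => /eqP.
by rewrite -addr_eq0 -mulr2n mulrn_eq0 /= sgr_eq0 (negPf d0).
Qed.

(** The vector [x] is supported on the chosen columns, so that it has only as
    many sign changes as the alternation forces. *)
Lemma variation_diminishing_minors m n (A : 'M[R]_(m, n)) q :
  (forall x : 'cV[R]_n, mixed_sign x ->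
      (Splus (A *m x) <= Sminus x)%N /\
      (Splus (A *m x) = Sminus x -> A *m x != 0 -> same_end_signs (A *m x) x)) ->
  (0 < q)%N -> negative_minors A q -> negative_minors A q.+1.
Proof.
move=> vd q0 neg f g fi gi; set M := mxsub f g A; rewrite ltNge; apply/negP => detM.
pose alpha : 'cV[R]_q.+1 := delta_mx ord0 0.
have alt1 : weakly_alternates 1 (fun k => alpha k 0).
  move=> k; rewrite mxE eqxx andbT mul1r.
  by case: eqVneq => [->|_]; rewrite ?expr0 ?mulr1 ?mulr0.
have alpha0 : alpha != 0.
  by apply/eqP => /matrixP/(_ ord0 0)/eqP; rewrite !mxE !eqxx oner_eq0.
have [z [zalt Mz]] : exists z : 'cV[R]_q.+1,
    strictly_alternates (-1) (fun k => z k 0) /\ M *m z = \det M *: alpha.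
  exists (\adj M *m alpha); rewrite mulmxA mul_mx_adj mul_scalar_mx; split=> //.
  by apply: adj_alternates; rewrite ?oner_eq0.
pose x := mxsub id g 1%:M *m z.
have xg k : x (g k) 0 = z k 0.
  rewrite mxE (bigD1 k) //= !mxE eqxx mul1r big1 ?addr0 // => l neq_lk.
  by rewrite !mxE (inj_eq (increasing_inj gi)) eq_sym (negPf neq_lk) mul0r.
have xsupp i : x i 0 != 0 -> i \in [set g k | k : 'I_q.+1].
  apply: contraNT => im; rewrite mxE big1 // => l _; rewrite !mxE.
  by case: eqVneq => [eq_il|_]; [rewrite eq_il imset_f in im | rewrite mul0r].
have xalt : strictly_alternates (-1) (fun k => x (g k) 0) by move=> k; rewrite xg.
have xmix := alternates_mixed q0 xalt; have [x0 _] := mixed_sign_Sminus xmix.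
have [qS ends] := Sminus_ge gi xalt.
have Sx : Sminus x = q.
  apply/eqP; rewrite eqn_leq qS andbT -ltnS.
  by have := Sminus_lt_support x0 xsupp; rewrite card_imset ?card_ord //; apply: increasing_inj.
have [Sw same] := vd x xmix.
apply: (@opposite_alternation_absurd _ _ (A *m x) x q f 1) => //; rewrite ?oner_eq0 //.
- by have [] := ends Sx.
- by move=> w0 eqS; apply: same.
move=> k; have -> : (A *m x) (f k) 0 = \det M * alpha k 0.
  have -> : A *m x = mxsub id g A *m z.
    rewrite mulmxA; congr (_ *m _); apply/matrixP => s t; rewrite mxE (bigD1 (g t)) //=.
    by rewrite !mxE eqxx mulr1 big1 ?addr0 // => l nl; rewrite !mxE (negPf nl) mulr0.
  by rewrite -mulmx_mxsubE Mz mxE.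
by rewrite mulrCA mulr_ge0.
Qed.

End Converse.

Theorem theorem1 (R : realType) (m n : nat) (hm : (2 <= m)%N) (hn : (2 <= n)%N)
    (A : 'M[R]_(m, n)) (hA : forall i j, A i j < 0)
    (alpha : forall r : nat, nat -> nat -> 'cV[R]_r)
    (halpha : forall r i j : nat, (2 <= r <= minn m n)%N ->
       (i + r <= m)%N -> (j + r <= n)%N ->
       alpha r i j != 0 /\ alternating_vector (alpha r i j)) :
  let cond1 := totally_negative A in
  let cond2 :=
    forall x : 'cV[R]_n, mixed_sign x ->
      (Splus (A *m x) <= Sminus x)%N /\
      (Splus (A *m x) = Sminus x -> A *m x != 0 -> same_end_signs (A *m x) x) in
  let cond3 :=
    forall (r i j : nat) (hi : (i + r <= m)%N) (hj : (j + r <= n)%N),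
      (2 <= r <= minn m n)%N ->
      let Ar := contiguous_submx hi hj A in
      let x := \adj Ar *m alpha r i j in
      (Splus (Ar *m x) <= Sminus x)%N /\
      (Splus (Ar *m x) = Sminus x -> same_end_signs (Ar *m x) x) in
  (cond1 <-> cond2) /\ (cond1 <-> cond3).
Proof.
move=> cond1 cond2 cond3.
have totally_negative_by_order :
    (forall q, (0 < q)%N -> negative_minors A q -> negative_minors A q.+1) -> cond1.
  move=> step; apply/totally_negativeP; elim=> // -[_ _|q IH _].
    by move=> f g _ _; rewrite det_mx11 mxE.
  exact/step/IH.
(* The vectors of the third condition alternate strictly, with first sign opposite
   to that of alpha, as soon as the minors of the next smaller order are negative. *)
have test_vector q i j (hi : (i + q.+1 <= m)%N) (hj : (j + q.+1 <= n)%N) :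
    (2 <= q.+1 <= minn m n)%N -> negative_minors A q ->
    let Ar := contiguous_submx hi hj A in
    exists d, [/\ d != 0, weakly_alternates d (fun k => alpha q.+1 i j k 0)
      & strictly_alternates (- d) (fun k => (\adj Ar *m alpha q.+1 i j) k 0)].
  move=> hq neg Ar; have [a0 /alternating_weak[d d0 alt]] := halpha _ _ _ hq hi hj.
  by exists d; split=> //; apply: adj_alternates => //; apply: increasing_shift.
have image r i j (hi : (i + r <= m)%N) (hj : (j + r <= n)%N) :
    let Ar := contiguous_submx hi hj A in
    Ar *m (\adj Ar *m alpha r i j) = \det Ar *: alpha r i j.
  by move=> Ar; rewrite mulmxA mul_mx_adj mul_scalar_mx.
split; split.
- by move=> /totally_negativeP neg x; apply: variation_diminishing.
- move=> vd; apply: totally_negative_by_order => q.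
  exact: variation_diminishing_minors.
- move=> /totally_negativeP neg [//|q] i j hi hj hq Ar x.
  have q0 : (0 < q)%N by case/andP: hq.
  have negAr r : (0 < r)%N -> negative_minors Ar r.
    by move=> r0; apply: negative_minors_mxsub (neg r r0); apply: increasing_shift.
  have [d [_ _ xalt]] := test_vector q i j hi hj hq (neg q q0).
  have [le same] := variation_diminishing negAr (@alternates_mixed _ _ x _ id _ q0 xalt).
  split=> // eqS; apply: same => //; rewrite image scaler_eq0 negb_or.
  have [-> _] := halpha _ _ _ hq hi hj; rewrite andbT lt_eqF //.
  by apply: (neg q.+1) => //; apply: increasing_shift.
- move=> vd; apply: totally_negative_by_order => q q0 neg.
  apply: negative_minors_contiguous => // i j hi hj; set Ar := contiguous_submx hi hj A.
  have hq : (2 <= q.+1 <= minn m n)%N by rewrite ltnS q0 leq_min; apply/andP; split; lia.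
  have [d [d0 alt xalt]] := test_vector q i j hi hj hq neg.
  rewrite ltNge; apply/negP => detAr.
  have [] := vd _ _ _ hi hj hq; rewrite -/Ar; set x := _ *m alpha _ _ _ => le same.
  have id_inc : increasing (@id 'I_q.+1) by [].
  have [qS ends] := @Sminus_ge _ _ x _ id _ id_inc xalt.
  have [x0 _] := mixed_sign_Sminus (@alternates_mixed _ _ x _ id _ q0 xalt).
  have Sx : Sminus x = q.
    apply/eqP; rewrite eqn_leq qS andbT -ltnS.
    have := @Sminus_lt_support _ _ x setT x0 (fun i _ => in_setT i).
    by rewrite cardsT card_ord.
  apply: (@opposite_alternation_absurd _ _ _ (Ar *m x) x q id d) => //.
    by have [] := ends Sx.
  by move=> k; rewrite image mxE mulrCA mulr_ge0.
Qed.
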